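(* Let $X$ and $Y$ be the first-hop and second-hop SNRs of the selected relay (independent, with the distributions given in the context), let $\zeta\ge 1$ be a constant, let $c=\mathbb{E}[X]+\zeta$, and let the fixed-gain end-to-end SNDR be $$\gamma=\frac{XY}{\zeta Y+\mathbb{E}[X]+\zeta}.$$ Then for every $\gamma_{\rm th}>0$ the outage probability $P_{\rm out}(\gamma_{\rm th})=\Pr[\gamma<\gamma_{\rm th}]$ equals $$P_{\rm out}(\gamma_{\rm th})=1-\frac{2k^2}{\bar\gamma_1}\binom{N}{k}^2\sum_{m=0}^{k-1}\sum_{n=0}^{k-1}\sum_{i=1}^{2}\sum_{j=1}^{2}S_mP_nT_{m,i}Q_{n,j}\sqrt{\frac{U_{m,i}\,c\,\gamma_{\rm th}}{R_{n,j}}}\,\exp\!\left(-\frac{R_{n,j}\zeta\gamma_{\rm th}}{\bar\gamma_1}\right)K_1\!\left(\frac{2}{\bar\gamma_1}\sqrt{U_{m,i}R_{n,j}\,c\,\gamma_{\rm th}}\right),$$ where $K_1$ is the modified Bessel function of the second kind of order $1$.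
   Context: Integers $1\le k\le N$ ($N$ relays, the relay of rank $k$ is selected), average SNRs $\bar\gamma_1,\bar\gamma_2>0$, correlation coefficients $\rho_1,\rho_2\in[0,1]$, and $\bar\gamma=\bar\gamma_1\bar\gamma_2/(\bar\gamma_1+\bar\gamma_2)$. For $0\le n,m\le k-1$ set $$P_n=\frac{(-1)^n\binom{k-1}{n}}{1+\frac{\bar\gamma_2}{\bar\gamma}(N-k+n)},\qquad S_m=\frac{(-1)^m\binom{k-1}{m}}{1+\frac{\bar\gamma_1}{\bar\gamma}(N-k+m)},$$ $$Q_{n,1}=1,\quad Q_{n,2}=\frac{(N-k+n)\bar\gamma_2}{\rho_1\bar\gamma+(1-\rho_1)(N-k+n+1)\bar\gamma_1},\qquad R_{n,1}=1,\quad R_{n,2}=\frac{(N-k+n+1)\bar\gamma_1}{\rho_1\bar\gamma+(1-\rho_1)(N-k+n+1)\bar\gamma_1},$$ $$T_{m,1}=1,\quad T_{m,2}=\frac{(N-k+m)\bar\gamma_1}{(N-k+m+1)\bar\gamma_2},\qquad U_{m,1}=\frac{\bar\gamma_1}{\bar\gamma_2},\quad U_{m,2}=\frac{(N-k+m+1)\bar\gamma_1}{\rho_2\bar\gamma+(1-\rho_2)(N-k+m+1)\bar\gamma_2}.$$ $X$ and $Y$ are independent nonnegative random variables; $X$ has density, for $x\ge 0$, $$f_X(x)=\frac{k}{\bar\gamma_1}\binom{N}{k}\sum_{n=0}^{k-1}\sum_{j=1}^{2}P_nQ_{n,j}\exp\!\left(-\frac{R_{n,j}x}{\bar\gamma_1}\right),$$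 and $Y$ has CDF, for $x\ge 0$, $$F_Y(x)=1-k\binom{N}{k}\sum_{m=0}^{k-1}\sum_{i=1}^{2}S_mT_{m,i}\exp\!\left(-\frac{U_{m,i}x}{\bar\gamma_1}\right).$$ *)

(* Defs.v *)
From HB Require Import structures.
From mathcomp Require Import all_boot all_order all_algebra.
From mathcomp Require Import all_classical all_reals all_analysis.

Set Implicit Arguments.
Unset Strict Implicit.
Unset Printing Implicit Defensive.

Import Order.TTheory GRing.Theory Num.Theory.
Import numFieldNormedType.Exports.

Local Open Scope classical_set_scope.
Local Open Scope ring_scope.

Definition cosh {R : realType} (t : R) : R := (expR t + expR (- t)) / 2.

(* Modified Bessel function of the second kind of real order [nu], for [x > 0]:
   K_nu(x) = int_0^oo exp(- x cosh t) cosh(nu t) dt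
   (Gradshteyn-Ryzhik 8.432.1, DLMF 10.32.9). For [x <= 0] the integral
   diverges and the value carries no meaning. *)
Definition besselK {R : realType} (nu x : R) : R :=
  Rintegral lebesgue_measure `[0, +oo[%classic
    (fun t : R => expR (- x * cosh t) * cosh (nu * t)).

Definition independent_RV {d} {T : measurableType d} {R : realType}
    {P : probability T R} (X Y : {RV P >-> R}) : Prop :=
  forall A B : set R, measurable A -> measurable B ->
    P (X @^-1` A `&` Y @^-1` B) = (P (X @^-1` A) * P (Y @^-1` B))%E.

Definition has_density {d} {T : measurableType d} {R : realType}
    {P : probability T R} (X : {RV P >-> R}) (f : R -> R) : Prop :=
  measurable_fun setT f /\
  forall A : set R, measurable A ->
    distribution P X A = (\int[lebesgue_measure]_(x in A) (f x)%:E)%E.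

(* In everything below [k <= N], so that [N - k] is the true difference; [g1]
   and [g2] are the average SNRs of the two hops, and the second index of
   Q, R, T and U ranges over {1, 2}. *)

Definition gbar {R : realType} (g1 g2 : R) : R := g1 * g2 / (g1 + g2).

Definition coefP {R : realType} (N k : nat) (g1 g2 : R) (n : nat) : R :=
  (-1) ^+ n * 'C(k.-1, n)%:R / (1 + g2 / gbar g1 g2 * (N - k + n)%:R).

Definition coefS {R : realType} (N k : nat) (g1 g2 : R) (m : nat) : R :=
  (-1) ^+ m * 'C(k.-1, m)%:R / (1 + g1 / gbar g1 g2 * (N - k + m)%:R).

Definition coefQ {R : realType} (N k : nat) (g1 g2 rho1 : R) (n j : nat) : R :=
  if j == 1%N then 1 else
  (N - k + n)%:R * g2
    / (rho1 * gbar g1 g2 + (1 - rho1) * (N - k + n + 1)%:R * g1).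

Definition coefR {R : realType} (N k : nat) (g1 g2 rho1 : R) (n j : nat) : R :=
  if j == 1%N then 1 else
  (N - k + n + 1)%:R * g1
    / (rho1 * gbar g1 g2 + (1 - rho1) * (N - k + n + 1)%:R * g1).

Definition coefT {R : realType} (N k : nat) (g1 g2 : R) (m i : nat) : R :=
  if i == 1%N then 1 else
  (N - k + m)%:R * g1 / ((N - k + m + 1)%:R * g2).

Definition coefU {R : realType} (N k : nat) (g1 g2 rho2 : R) (m i : nat) : R :=
  if i == 1%N then g1 / g2 else
  (N - k + m + 1)%:R * g1
    / (rho2 * gbar g1 g2 + (1 - rho2) * (N - k + m + 1)%:R * g2).

Definition hop1_pdf {R : realType} (N k : nat) (g1 g2 rho1 : R) (x : R) : R :=
  if 0 <= x then
    k%:R / g1 * 'C(N, k)%:R *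
    \sum_(0 <= n < k) \sum_(1 <= j < 3)
      coefP N k g1 g2 n * coefQ N k g1 g2 rho1 n j
        * expR (- (coefR N k g1 g2 rho1 n j * x / g1))
  else 0.

(* The CDF for [0 <= x] only: no truncation at 0. *)
Definition hop2_cdf {R : realType} (N k : nat) (g1 g2 rho2 : R) (x : R) : R :=
  1 - k%:R * 'C(N, k)%:R *
    \sum_(0 <= m < k) \sum_(1 <= i < 3)
      coefS N k g1 g2 m * coefT N k g1 g2 m i
        * expR (- (coefU N k g1 g2 rho2 m i * x / g1)).

(* Main.v *)
Require Import Defs.
From HB Require Import structures.
From mathcomp Require Import all_boot all_order all_algebra.
From mathcomp Require Import all_classical all_reals all_analysis.
From mathcomp Require Import measurable_realfun ring.

Set Implicit Arguments.
Unset Strict Implicit.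
Unset Printing Implicit Defensive.

Import Order.TTheory GRing.Theory Num.Theory.
Import numFieldNormedType.Exports.

Local Open Scope classical_set_scope.
Local Open Scope ring_scope.

(** The event [gamma < gth] fails exactly when [X > zeta * gth] and
    [Y >= c * gth / (X - zeta * gth)]. By independence and Tonelli its
    complement has probability
    [\int_(zeta gth)^oo (1 - F_Y (c gth / (x - zeta gth))) f_X(x) dx], a finite
    linear combination of integrals
    [\int_a^oo exp (- p (x - a)) exp (- q / (x - a)) dx], each equal to
    [2 sqrt (q / p) K_1 (2 sqrt (p q))] by the substitution
    [x = a + sqrt (q / p) e^t]. *)

(** * Exponential change of variables on a ray, and folding of the real line *)

Section exp_substitution.
Context {R : realType}.
Implicit Types (a s : R) (G : R -> R).
Notation mu := lebesgue_measure.

Let is_derive_exp_affine a s (t : R) :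
  is_derive t 1 (fun x : R => a + s * expR x) (s * expR t).
Proof.
by apply: is_derive_eq; rewrite add0r mul1r.
Qed.

Let derive1_exp_affine a s :
  (fun t : R => a + s * expR t)^`()%classic = (fun t => s * expR t).
Proof.
apply/funext => t; rewrite derive1E.
exact: (@derive_val _ _ _ _ _ _ _ (is_derive_exp_affine a s t)).
Qed.

Let continuous_exp_affine a s : continuous (fun t : R => a + s * expR t).
Proof.
move=> t; apply: cvgD; first exact: cvg_cst.
by apply: cvgM; [exact: cvg_cst|exact: continuous_expR].
Qed.

(* The improper substitution lemmas of [ftc.v] require [F^`()] to converge at
   [+oo], which excludes [expR]; hence the exhaustion by compact intervals. *)
Lemma ge0_integration_by_substitution_exp a s G : 0 < s ->
  {in `]a, +oo[, continuous G} -> {in `]a, +oo[, forall x, 0 <= G x} ->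
  (\int[mu]_(x in `]a, +oo[) (G x)%:E =
   \int[mu]_t (G (a + s * expR t) * (s * expR t))%:E)%E.
Proof.
move=> s0 cG G0.
pose F (t : R) := a + s * expR t.
have Fgt t : a < F t by rewrite ltrDl mulr_gt0// expR_gt0.
have Fle : {mono F : x y / x <= y}.
  by move=> x y; rewrite /F lerD2l ler_pM2l// ler_expR.
have Flt := leW_mono Fle.
have mG (A : set R) : A `<=` `]a, +oo[ -> measurable A -> measurable_fun A G.
  move=> Aa mA; apply: (@measurable_funS _ _ _ _ `]a, +oo[) => //.
  apply: open_continuous_measurable_fun; first exact: interval_open.
  by move=> x; rewrite inE => ax; exact: cG.
pose H t := G (F t) * (s * expR t).
have cH : continuous H.
  move=> t; apply: cvgM; last first.
    by apply: cvgM; [exact: cvg_cst|exact: continuous_expR].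
  apply: continuous_comp; first exact: continuous_exp_affine.
  by apply: cG; rewrite in_itv/= Fgt.
have H0 t : 0 <= H t.
  by rewrite mulr_ge0 ?(mulr_ge0 (ltW s0)) ?expR_ge0// G0// in_itv/= Fgt.
have E n : (\int[mu]_(x in `[F (- n%:R)%R, F n%:R%R]) (G x)%:E =
            \int[mu]_(x in `[(- n%:R)%R, n%:R%R]) (H x)%:E)%E.
  rewrite (@integration_by_substitution_increasing _ F).
  - by rewrite derive1_exp_affine.
  - by rewrite ge0_cp.
  - by move=> x y _ _ xy; rewrite Flt.
  - rewrite derive1_exp_affine => t _.
    by apply: cvgM; [exact: cvg_cst|exact: continuous_expR].
  - rewrite derive1_exp_affine; apply/cvg_ex; exists (s * expR (- n%:R)).
    apply: cvg_at_right_filter.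
    by apply: cvgM; [exact: cvg_cst|exact: continuous_expR].
  - rewrite derive1_exp_affine; apply/cvg_ex; exists (s * expR n%:R).
    apply: cvg_at_left_filter.
    by apply: cvgM; [exact: cvg_cst|exact: continuous_expR].
  - split.
    + by move=> t _; exact: ex_derive.
    + by apply: cvg_at_right_filter; exact: continuous_exp_affine.
    + by apply: cvg_at_left_filter; exact: continuous_exp_affine.
  - apply: continuous_in_subspaceT => x; rewrite inE/= in_itv/= => /andP[Fx _].
    by apply: cG; rewrite in_itv/= andbT (lt_le_trans _ Fx).
(* The preimage of [x] under [F] is [ln ((x - a) / s)], so any natural number above its absolute
   value indexes an interval containing [x]. *)
have UF : \bigcup_n `[F (- n%:R), F n%:R]%classic = `]a, +oo[%classic.
  apply/seteqP; split=> [x [n _]/=|x /=].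
    by rewrite !in_itv/= andbT => /andP[+ _]; exact: lt_le_trans.
  rewrite in_itv/= andbT => ax.
  have xa : 0 < (x - a) / s by rewrite divr_gt0// subr_gt0.
  have xE : x = F (ln ((x - a) / s)).
    by rewrite /F lnK ?posrE// mulrCA divff ?gt_eqF// mulr1 subrKC.
  rewrite xE; exists (Num.bound `|ln ((x - a) / s)|) => //=.
  rewrite in_itv/= !Fle -ler_norml.
  by rewrite ltW// archi_boundP.
have UT : \bigcup_n `[- n%:R, n%:R]%classic = [set: R].
  apply/seteqP; split=> // x _; exists (Num.bound `|x|) => //=.
  by rewrite in_itv/= -ler_norml ltW// archi_boundP.
have c1 : (\int[mu]_(x in `[F (- n%:R)%R, F n%:R%R]) (G x)%:E @[n --> \oo] -->
    \int[mu]_(x in `]a, +oo[) (G x)%:E)%E.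
  rewrite -UF; apply: ge0_nondecreasing_set_cvg_integral => //.
  - move=> m n mn; apply/subsetPset; apply: subset_itv => //;
      by rewrite bnd_simp Fle ?lerN2 ler_nat.
  - move=> n; apply/measurable_EFinP; apply: mG => //.
    by rewrite -UF => x xn; exists n.
  - move=> n x xn; rewrite lee_fin G0//.
    by have : `]a, +oo[%classic x by rewrite -UF; exists n.
have c2 : (\int[mu]_(x in `[(- n%:R)%R, n%:R%R]) (H x)%:E @[n --> \oo] -->
    \int[mu]_x (H x)%:E)%E.
  rewrite -UT; apply: ge0_nondecreasing_set_cvg_integral => //.
  - move=> m n mn; apply/subsetPset; apply: subset_itv => //;
      by rewrite bnd_simp ?lerN2 ler_nat.
  - move=> n; apply/measurable_EFinP/measurable_funTS.
    exact: continuous_measurable_fun.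
  - by move=> n x _; rewrite lee_fin.
have EE : (fun n => \int[mu]_(x in `[F (- n%:R)%R, F n%:R%R]) (G x)%:E)%E =
  (fun n => \int[mu]_(x in `[(- n%:R)%R, n%:R%R]) (H x)%:E)%E by exact/funext.
by rewrite EE in c1; exact: cvg_unique c1 c2.
Qed.

(** Split at [0] and reflect the negative half-line. This is how a factor [exp t] on the line
    becomes the [cosh] on the half-line that [besselK] requires. *)
Lemma ge0_integralT_symmetrize (f : R -> R) :
  continuous f -> (forall x, 0 <= f x) ->
  (\int[mu]_x (f x)%:E = \int[mu]_(x in `[0%R, +oo[) (f x + f (- x))%:E)%E.
Proof.
move=> cf f0.
have mf : measurable_fun setT f by exact: continuous_measurable_fun.
have mfN : measurable_fun setT (f \o -%R).
  by apply: measurableT_comp => //; exact: oppr_measurable.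
have -> : [set: R] = `]-oo, 0] `|` `]0, +oo[.
  by rewrite -setCitvr setvU.
rewrite ge0_integral_setU//=; first last.
- rewrite disj_set2E; apply/eqP; rewrite -subset0 => x/=.
  by rewrite !in_itv/= andbT ltNge => -[-> ].
- by move=> x _; rewrite lee_fin.
- exact/measurable_EFinP/measurable_funTS.
rewrite integral_itv_obnd_cbnd; last exact/measurable_EFinP/measurable_funTS.
have := @ge0_integration_by_substitutionNy R f 0.
rewrite oppr0 => ->; last 2 first.
- exact: continuous_subspaceT.
- by move=> x _.
rewrite -ge0_integralD//=.
- by apply: eq_integral => x _; rewrite addeC.
- by move=> x _; rewrite lee_fin.
- exact/measurable_EFinP/measurable_funTS.
- by move=> x _; rewrite lee_fin.
- exact/measurable_EFinP/measurable_funTS.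
Qed.

End exp_substitution.

(** * The two-exponential integral on a ray as a Bessel function *)

Section besselK1_integral.
Context {R : realType}.
Implicit Types a p q : R.
Notation mu := lebesgue_measure.

Let expdecay a p x : R := expR (- (p * (x - a))).

(** After translation to [a = 0], the integrand is at most [p^-1] times the exponential density of
    rate [p], which has total mass 1. *)
Let integral_expdecay_lty a p : 0 < p ->
  (\int[mu]_(x in `]a, +oo[) (expdecay a p x)%:E < +oo)%E.
Proof.
move=> p0.
have c b : continuous (expdecay b p).
  move=> x; apply: continuous_comp; last exact: continuous_expR.
  apply: cvgN; apply: cvgM; first exact: cvg_cst.
  by apply: cvgB; [exact: cvg_id|exact: cvg_cst].
have -> : (\int[mu]_(x in `]a, +oo[) (expdecay a p x)%:E =
           \int[mu]_(x in `]0%R, +oo[) (expdecay 0 p x)%:E)%E.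
  have sub b := @ge0_integration_by_substitution_exp R b 1 (expdecay b p) ltr01
    (fun x _ => c b x) (fun x _ => expR_ge0 _).
  (* Translation invariance comes from substituting [x = b + exp t] on both sides, for [b = a] and
     [b = 0]: the resulting integrands on the line coincide. *)
  rewrite !sub.
  apply: eq_integral => t _.
  by rewrite /expdecay add0r subr0 addrAC subrr add0r.
have mpdf := @measurable_exponential_pdf R p.
apply: (@le_lt_trans _ _
    (p^-1%:E * \int[mu]_x (exponential_pdf p x)%:E)%E); last first.
  by rewrite integral_exponential_pdf// mule1 ltry.
rewrite -ge0_integralZl//=; last 3 first.
- exact/measurable_EFinP.
- by move=> x _; rewrite lee_fin exponential_pdf_ge0// ltW.
- by rewrite lee_fin invr_ge0 ltW.
rewrite integral_mkcond; apply: ge0_le_integral => //=.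
- by move=> x _; rewrite patchE; case: ifP => // _; rewrite lee_fin expR_ge0.
- apply/(measurable_restrictT _ _).1 => //; apply/measurable_EFinP.
  by apply: measurable_funTS; exact: continuous_measurable_fun.
- by apply: emeasurable_funM => //; exact/measurable_EFinP.
move=> x _; rewrite patchE; case: ifPn => [|_].
  rewrite inE/= in_itv/= andbT => x0; rewrite (exponential_pdfE _ (ltW x0)).
  by rewrite -EFinM mulrA mulVf ?gt_eqF// mul1r /expdecay subr0 mulNr.
(* Off the ray the restricted function takes the default value [point], which is [0] here. *)
rewrite (_ : point = 0%E)// -EFinM lee_fin mulr_ge0 ?invr_ge0 ?(ltW p0)//.
by rewrite exponential_pdf_ge0 ?ltW.
Qed.

Let continuous_expR_expRV a p q : {in `]a, +oo[, continuous
  (fun x => expR (- (p * (x - a))) * expR (- (q / (x - a))))}.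
Proof.
move=> x; rewrite in_itv/= andbT => ax; apply: cvgM.
  apply: continuous_comp; last exact: continuous_expR.
  apply: cvgN; apply: cvgM; first exact: cvg_cst.
  by apply: cvgB; [exact: cvg_id|exact: cvg_cst].
apply: continuous_comp; last exact: continuous_expR.
apply: cvgN; apply: cvgM; first exact: cvg_cst.
apply: cvgV; first by rewrite gt_eqF// subr_gt0.
by apply: cvgB; [exact: cvg_id|exact: cvg_cst].
Qed.

(** On the ray the second factor is at most 1, so [expdecay a p] dominates. *)
Lemma integrable_expR_expRV a p q : 0 < p -> 0 <= q ->
  mu.-integrable `]a, +oo[
    (fun x => (expR (- (p * (x - a))) * expR (- (q / (x - a))))%:E).
Proof.
move=> p0 q0.
have mE : measurable_fun `]a, +oo[ (fun x => (expdecay a p x)%:E).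
  apply/measurable_EFinP; apply: measurable_funTS.
  apply: continuous_measurable_fun => x.
  apply: continuous_comp; last exact: continuous_expR.
  apply: cvgN; apply: cvgM; first exact: cvg_cst.
  by apply: cvgB; [exact: cvg_id|exact: cvg_cst].
have iE : mu.-integrable `]a, +oo[ (fun x => (expdecay a p x)%:E).
  apply/integrableP; split => //.
  under eq_integral do rewrite gee0_abs ?lee_fin ?expR_ge0//.
  exact: integral_expdecay_lty.
apply: le_integrable iE => //.
  apply/measurable_EFinP.
  apply: open_continuous_measurable_fun; first exact: interval_open.
  by move=> x; rewrite inE; exact: continuous_expR_expRV.
move=> x /=; rewrite in_itv/= andbT => ax.
rewrite lee_fin !ger0_norm ?mulr_ge0 ?expR_ge0//.
rewrite ler_piMr ?expR_ge0// -expR0 ler_expR oppr_le0.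
by rewrite divr_ge0// subr_ge0 ltW.
Qed.

(* Substitute [x = a + sqrt (q / p) * exp t] and fold the line at [t = 0]. *)
Lemma integral_expR_expRV_besselK a p q : 0 < p -> 0 < q ->
  (\int[mu]_(x in `]a, +oo[)
      (expR (- (p * (x - a))) * expR (- (q / (x - a))))%:E =
   (2 * Num.sqrt (q / p) * besselK 1 (2 * Num.sqrt (p * q)))%:E)%E.
Proof.
move=> p0 q0.
have iG := integrable_expR_expRV a p0 (ltW q0).
(* This scale balances the two exponents: [p * s = q / s = sqrt (p q)], hence
   [p s exp t + (q / s) exp (- t) = z cosh t]. *)
pose s := Num.sqrt (q / p); pose z := 2 * Num.sqrt (p * q).
have s0 : 0 < s by rewrite sqrtr_gt0 divr_gt0.
have ps : p * s = Num.sqrt (p * q).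
  rewrite /s -{1}(ger0_norm (ltW p0)) -sqrtr_sqr -sqrtrM ?sqr_ge0//.
  by congr Num.sqrt; field; rewrite gt_eqF.
have qs : q / s = Num.sqrt (p * q).
  have qE : q = p * s ^+ 2.
    by rewrite sqr_sqrtr ?divr_ge0 ?ltW//; field; rewrite gt_eqF.
  by rewrite -ps {1}qE; field; rewrite gt_eqF.
pose w t : R := expR (- z * cosh t) * cosh (1 * t).
have w0 t : 0 <= w t.
  by rewrite mulr_ge0 ?expR_ge0// divr_ge0// addr_ge0 ?expR_ge0.
have cexpN : continuous (fun t : R => expR (- t)).
  by move=> t; apply: continuous_comp; [exact: cvgN|exact: continuous_expR].
have ccosh : continuous (@cosh R).
  move=> t; apply: cvgM; last exact: cvg_cst.
  by apply: cvgD; [exact: continuous_expR|exact: cexpN].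
have ce : continuous (fun t => expR (- z * cosh t)).
  move=> t; apply: continuous_comp; last exact: continuous_expR.
  by apply: cvgM; [exact: cvg_cst|exact: ccosh].
have cw : continuous w.
  move=> t; apply: cvgM; first exact: ce.
  rewrite mul1r (_ : (fun t => cosh (1 * t)) = @cosh R); first exact: ccosh.
  by apply/funext => u; rewrite mul1r.
pose f t := s * expR (- z * cosh t) * expR t.
have E : (\int[mu]_(x in `]a, +oo[)
    (expR (- (p * (x - a))) * expR (- (q / (x - a))))%:E =
    (2 * s)%:E * \int[mu]_(t in `[0%R, +oo[) (w t)%:E)%E.
  rewrite (ge0_integration_by_substitution_exp s0); last 2 first.
  - exact: continuous_expR_expRV.
  - by move=> x _; rewrite mulr_ge0 ?expR_ge0.
  transitivity (\int[mu]_t (f t)%:E)%E.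
    apply: eq_integral => t _; congr EFin; rewrite /f.
    have -> : a + s * expR t - a = s * expR t by rewrite addrAC subrr add0r.
    have -> : q / (s * expR t) = Num.sqrt (p * q) * expR (- t).
      by rewrite invfM mulrA qs expRN.
    rewrite -expRD !mulrA ps -opprD -mulrDr (mulrC _ s).
    by congr (s * expR _ * _); rewrite /z /cosh; field.
  rewrite ge0_integralT_symmetrize; last 2 first.
  - move=> t; apply: cvgM; last exact: continuous_expR.
    by apply: cvgM; [exact: cvg_cst|exact: ce].
  - by move=> t; rewrite !mulr_ge0 ?expR_ge0// ltW.
  rewrite -ge0_integralZl//=; last 3 first.
  - by apply/measurable_EFinP/measurable_funTS; exact: continuous_measurable_fun.
  - by move=> t _; rewrite lee_fin.
  - by rewrite lee_fin mulr_ge0// ltW.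
  (* Since [cosh] is even, [f t + f (- t) = s exp (- z cosh t) (exp t + exp (- t)) = 2 s w t]. *)
  apply: eq_integral => t _; rewrite -EFinM; congr EFin.
  have coshN : cosh (- t) = cosh t by rewrite /cosh opprK addrC.
  by rewrite /f /w coshN mul1r [in RHS]/cosh; field.
rewrite /besselK /Rintegral [RHS]EFinM fineK//.
(* [besselK] takes [fine] of this integral, so finiteness must be known. It is read backwards from
   [E]: an infinite value would make the left-hand side infinite, against [iG]. *)
have fin : (\int[mu]_(t in `[0%R, +oo[) (w t)%:E < +oo)%E.
  rewrite ltNge leye_eq; apply/negP => /eqP woo.
  have := integrable_lty _ iG.
  by rewrite E woo gt0_muley ?lte_fin ?mulr_gt0// ltxx => /(_ (measurable_itv _)).
by rewrite ge0_fin_numE//; apply: integral_ge0 => t _; rewrite lee_fin w0.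
Qed.

End besselK1_integral.

(** * Measure theory: null sets, densities and independence *)

(** Each set is contained in the union of the other with the exceptional null set. *)
Lemma ae_iff_measure d (T : measurableType d) (R : realType)
    (mu : {measure set T -> \bar R}) (A B : set T) :
  measurable A -> measurable B -> {ae mu, forall x, A x <-> B x} ->
  mu A = mu B.
Proof.
move=> mA mB [N [mN muN AB]].
suff le C D : measurable C -> measurable D ->
    (forall x, ~ N x -> C x -> D x) -> (mu C <= mu D)%E.
  apply/eqP; rewrite eq_le !le// => x Nx; apply: contrapT => nAB; apply: Nx;
    by apply: AB => /= -[]; tauto.
move=> mC mD CD; rewrite -(measureU0 mD mN muN) le_measure ?inE//.
  exact: measurableU.
by move=> x Cx; have [Nx|Nx] := pselect (N x); [right|left; exact: CD].
Qed.

(** The sign of [f] is unknown, as for the alternating sums of [hop1_pdf]. Instead, [f] agrees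
    almost everywhere on [U] with the Radon-Nikodym derivative, both having the same integral over
    every measurable subset. *)
Lemma integral_density d (T : measurableType d) (R : realType)
    (nu : {finite_measure set T -> \bar R})
    (mu : {sigma_finite_measure set T -> \bar R})
    (f : T -> R) (U : set T) (g : T -> \bar R) :
  measurable_fun setT f ->
  (forall A, measurable A -> nu A = (\int[mu]_(x in A) (f x)%:E)%E) ->
  measurable U -> nu.-integrable U g ->
  (\int[nu]_(x in U) g x = \int[mu]_(x in U) (g x * (f x)%:E))%E.
Proof.
move=> mf nuf mU ig.
have mfU (A : set T) : measurable_fun A (EFin \o f).
  exact/measurable_EFinP/measurable_funTS.
have dom : nu `<< mu.
  by apply/null_content_dominatesP => A mA A0; rewrite nuf// null_set_integral.
rewrite -(Radon_Nikodym_change_of_variables dom mU ig).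
have mg := measurable_int _ ig.
have iRN : mu.-integrable U (Radon_Nikodym (charge_of_finite_measure nu) mu).
  by apply: (integrableS measurableT) => //; exact: Radon_Nikodym_integrable.
apply: ae_eq_integral => //.
- by apply: emeasurable_funM => //; exact: (measurable_int _ iRN).
- exact: emeasurable_funM.
- apply: ae_eqe_mul2l; apply: integral_ae_eq => //.
  by move=> E EU mE; rewrite -Radon_Nikodym_integral//=; exact: nuf.
Qed.

(** Independence makes the law of the pair agree with the product measure on rectangles, hence on
    all measurable sets. The right-hand side is the product measure of [S] by definition. *)
Lemma independent_xsection d d1 d2 (T : measurableType d)
    (T1 : measurableType d1) (T2 : measurableType d2) (R : realType)
    (P : probability T R) (X : {mfun T >-> T1}) (Y : {mfun T >-> T2})
    (S : set (T1 * T2)) :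
  (forall A B, measurable A -> measurable B ->
    P (X @^-1` A `&` Y @^-1` B) = (P (X @^-1` A) * P (Y @^-1` B))%E) ->
  measurable S ->
  P [set w | S (X w, Y w)] =
  (\int[distribution P X]_x distribution P Y (xsection S x))%E.
Proof.
move=> XY mS.
pose XxY w := (X w, Y w).
have mXY : measurable_fun setT XxY by exact: measurable_fun_pair.
pose mixin := isMeasurableFun.Build _ _ _ _ XxY mXY.
pose Z : {mfun T >-> _} := HB.pack XxY mixin.
rewrite -[RHS]/(product_measure1 (distribution P X) (distribution P Y) S).
rewrite (@product_measure_unique _ _ _ _ _ _ _ (distribution P Z))//.
Qed.

(** * Half-line probabilities from a CDF *)

Section distribution_lemmas.
Context d (T : measurableType d) (R : realType) (P : probability T R).
Implicit Types Y : {RV P >-> R}.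

(** Continuity rules out an atom at [y]: the probability is bounded above by the CDF at [y] and
    below by its values to the left of [y], which tend to [F y]. *)
Lemma distribution_itvNyo Y (F : R -> R) (y : R) :
  (\forall x \near y, cdf Y x = (F x)%:E) -> {for y, continuous F} ->
  distribution P Y `]-oo, y[ = (F y)%:E.
Proof.
move=> YF cF.
have Yfin (A : set R) : measurable A -> distribution P Y A \is a fin_num.
  by move=> mA; exact: fin_num_measure.
apply/eqP; rewrite eq_le; apply/andP; split.
  rewrite -(nbhs_singleton YF) le_measure ?inE//.
  by apply: subset_itvl; rewrite bnd_simp.
rewrite -[leRHS]fineK ?Yfin// lee_fin.
have cl : F x @[x --> y^'-] --> F y by exact: cvg_at_left_filter.
rewrite -(cvg_lim _ cl)//; apply: limr_le; first by apply/cvg_ex; exists (F y).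
near=> x; rewrite -lee_fin fineK ?Yfin//.
rewrite -(_ : cdf Y x = (F x)%:E); last by near: x; exact: cvg_within.
rewrite le_measure ?inE//; apply: subset_itvl; rewrite bnd_simp.
by near: x; exact: nbhs_left_lt.
Unshelve. all: end_near. Qed.

Lemma distribution_itvcy Y (y : R) :
  distribution P Y `[y, +oo[ = (1 - distribution P Y `]-oo, y[)%E.
Proof. by rewrite -setCitvl probability_setC. Qed.

End distribution_lemmas.

(** * Positivity of the exponential rates and continuity of the second-hop CDF *)

Section relay_coefficients.
Context {R : realType}.
Variables (N k : nat) (g1 g2 rho : R).
Hypotheses (hg1 : 0 < g1) (hg2 : 0 < g2) (hrho : 0 <= rho <= 1).

Lemma gbar_gt0 : 0 < gbar g1 g2.
Proof. by rewrite divr_gt0 ?mulr_gt0 ?addr_gt0. Qed.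

(** The denominators in [coefR] and [coefU] have this shape, with [x] equal to [gbar g1 g2]. The
    endpoint [rho = 0] is treated apart because the first term then vanishes. *)
Let mix_gt0 (x y : R) : 0 < x -> 0 < y -> 0 < rho * x + (1 - rho) * y.
Proof.
move=> x0 y0; have /andP[r0 r1] := hrho.
move: r0; rewrite le_eqVlt => /predU1P[<-|r0].
  by rewrite mul0r add0r subr0 mul1r.
by rewrite ltr_pwDl ?mulr_gt0// mulr_ge0 ?subr_ge0// ltW.
Qed.

Lemma coefR_gt0 n j : 0 < coefR N k g1 g2 rho n j.
Proof.
rewrite /coefR; case: ifP => // _.
have n0 : 0 < (N - k + n + 1)%:R :> R by rewrite ltr0n addn1.
by rewrite divr_gt0 ?mulr_gt0// -mulrA mix_gt0 ?gbar_gt0// mulr_gt0.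
Qed.

Lemma coefU_gt0 m i : 0 < coefU N k g1 g2 rho m i.
Proof.
rewrite /coefU; case: ifP => _; first by rewrite divr_gt0.
have n0 : 0 < (N - k + m + 1)%:R :> R by rewrite ltr0n addn1.
by rewrite divr_gt0 ?mulr_gt0// -mulrA mix_gt0 ?gbar_gt0// mulr_gt0.
Qed.

Lemma continuous_hop2_cdf : continuous (hop2_cdf N k g1 g2 rho).
Proof.
move=> x; apply: cvgB; first exact: cvg_cst.
apply: cvgM; first exact: cvg_cst.
apply: cvg_big => [|m _]; first exact: add_continuous.
apply: cvg_big => [|i _]; first exact: add_continuous.
apply: cvgM; first exact: cvg_cst.
apply: continuous_comp; last exact: continuous_expR.
apply: cvgN; apply: cvgM; last exact: cvg_cst.
by apply: cvgM; [exact: cvg_cst|exact: cvg_id].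
Qed.

End relay_coefficients.

(** * Linear combinations of integrals with known values *)

Section has_integral.
Context d (T : measurableType d) (R : realType) (mu : {measure set T -> \bar R}).
Variables (D : set T) (mD : measurable D).

(** Integrability travels with the value because the sums have terms of both signs, so linearity
    cannot rest on nonnegativity. *)
Definition has_integral (f : T -> R) (v : R) :=
  mu.-integrable D (EFin \o f) /\ (\int[mu]_(x in D) (f x)%:E = v%:E)%E.

Lemma has_integralZ f v c : has_integral f v ->
  has_integral (fun x => c * f x) (c * v).
Proof.
move=> [fi fv]; split; first exact: (@integrableZl _ _ _ _ _ mD c (EFin \o f) fi).
by under eq_integral do rewrite EFinM; rewrite integralZl// fv EFinM.
Qed.

Lemma has_integral_sum I (s : seq I) (f : I -> T -> R) (v : I -> R) :
  (forall i, has_integral (f i) (v i)) ->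
  has_integral (fun x => \sum_(i <- s) f i x) (\sum_(i <- s) v i).
Proof.
move=> fv; have E : EFin \o (fun x => \sum_(i <- s) f i x) =
    (fun x => \sum_(i <- s) (f i x)%:E)%E.
  by apply/funext => x /=; rewrite sumEFin.
have fi i : mu.-integrable D (fun x => (f i x)%:E) by have [] := fv i.
split; first by rewrite E; exact: integrable_sum.
rewrite [LHS](_ : _ = \int[mu]_(x in D) \sum_(i <- s) (f i x)%:E)%E.
  rewrite integral_sum// -sumEFin; apply: eq_bigr => i _.
  by have [] := fv i.
by apply: eq_integral => x _; rewrite sumEFin.
Qed.

End has_integral.

(** With [p = r / g] and [q = u kappa / g], shifting [x] to [x - a] extracts [exp (- r a / g)]. The
    scale [g] cancels in [q / p], while [sqrt (p q) = sqrt (u r kappa) / g]. *)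
Lemma has_integral_expR_expRV {R : realType} (r u g a kappa : R) :
  0 < r -> 0 < u -> 0 < g -> 0 < kappa ->
  has_integral lebesgue_measure `]a, +oo[
    (fun x => expR (- (u * (kappa / (x - a)) / g)) * expR (- (r * x / g)))
    (Num.sqrt (u * kappa / r) * expR (- (r * a / g))
       * besselK 1 (2 / g * Num.sqrt (u * r * kappa)) * 2).
Proof.
move=> r0 u0 g0 k0.
pose p := r / g; pose q := u * kappa / g.
have p0 : 0 < p by rewrite divr_gt0.
have q0 : 0 < q by rewrite divr_gt0 ?mulr_gt0.
have -> : Num.sqrt (u * kappa / r) = Num.sqrt (q / p).
  by congr Num.sqrt; rewrite /q /p; field; rewrite !gt_eqF.
have -> : 2 / g * Num.sqrt (u * r * kappa) = 2 * Num.sqrt (p * q).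
  rewrite -mulrA; congr (2 * _).
  have -> : p * q = g^-1 ^+ 2 * (u * r * kappa).
    by rewrite /q /p; field; rewrite gt_eqF.
  by rewrite [RHS]sqrtrM ?sqr_ge0// sqrtr_sqr ger0_norm// invr_ge0 ltW.
have -> : (fun x =>
      expR (- (u * (kappa / (x - a)) / g)) * expR (- (r * x / g))) =
    (fun x => expR (- (r * a / g)) *
              (expR (- (p * (x - a))) * expR (- (q / (x - a))))).
  apply/funext => x; rewrite -!expRD; congr expR; rewrite /p /q.
  by ring.
rewrite (_ : _ * 2 = expR (- (r * a / g)) *
    (2 * Num.sqrt (q / p) * besselK 1 (2 * Num.sqrt (p * q)))); last by field.
apply: has_integralZ => //; split.
  exact: integrable_expR_expRV (ltW q0).
exact: integral_expR_expRV_besselK.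
Qed.

(** * The non-outage region and the outage probability *)

(** The section of the region at [x] is [[kappa / (x - a), +oo[] when [a < x] and empty
    otherwise. *)
Lemma distribution_snr_region d (T : measurableType d) (R : realType)
    (P : probability T R) (X Y : {RV P >-> R}) (f ccdf : R -> R) (a kappa : R) :
  independent_RV X Y ->
  0 < kappa -> has_density X f ->
  (forall y, 0 < y -> distribution P Y `[y, +oo[ = (ccdf y)%:E) ->
  P [set w | a < X w /\ kappa <= Y w * (X w - a)] =
  (\int[lebesgue_measure]_(x in `]a, +oo[)
     (ccdf (kappa / (x - a)) * f x)%:E)%E.
Proof.
move=> hXY k0 [mf Xf] Yccdf.
(* [lebesgue_measure] lives on [measurableTypeR R], whose display differs from
   that of [R] although the measurable sets agree; [X'] is [X] seen there. *)
have mX' : measurable_fun setT (X : T -> measurableTypeR R).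
  exact: (@measurable_funPT _ _ _ _ X).
pose mixin := isMeasurableFun.Build _ _ _ (measurableTypeR R)
  (X : T -> measurableTypeR R) mX'.
pose X' : {mfun T >-> measurableTypeR R} :=
  HB.pack (X : T -> measurableTypeR R) mixin.
pose S := [set p : measurableTypeR R * R |
  (a : R) < p.1 /\ kappa <= p.2 * (p.1 - a)].
have mid : measurable_fun setT (id : measurableTypeR R -> R) by [].
have m1 : measurable_fun setT (fun p : measurableTypeR R * R => p.1 : R).
  exact: (measurableT_comp mid measurable_fst).
have mS : measurable S.
  have -> : S = (fun p : measurableTypeR R * R =>
      ((a : R) < p.1) && (kappa <= p.2 * (p.1 - a))) @^-1` [set true].
    by apply/seteqP; split=> p /= => [[-> ->]|/andP[]].
  rewrite -[X in measurable X]setTI.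
  apply: measurable_and => //; first exact: measurable_fun_ltr.
  apply: measurable_fun_ler => //; apply: measurable_funM => //.
  exact: measurable_funB.
rewrite (@independent_xsection _ _ _ _ _ _ _ P X' Y S)//.
have mg := measurable_fun_xsection (distribution P Y) mS.
rewrite (@integral_density _ _ _ (distribution P X') lebesgue_measure f)//;
  last first.
  apply: (le_integrable measurableT mg _
    (finite_measure_integrable_cst _ 1 measurableT)).
  move=> x _ /=; rewrite gee0_abs// normr1.
  by apply: probability_le1; exact: measurable_xsection.
rewrite [RHS]integral_mkcond; apply: eq_integral => x _; rewrite patchE.
case: ifPn => [|].
  rewrite inE/= in_itv/= andbT => ax.
  have -> : xsection S x = `[kappa / (x - a), +oo[%classic.
    apply/seteqP; split=> y; rewrite /xsection/= inE/= in_itv/= andbT.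
      by case=> _; rewrite ler_pdivrMr// subr_gt0.
    by rewrite ler_pdivrMr ?subr_gt0.
  by rewrite Yccdf ?divr_gt0 ?subr_gt0// EFinM.
rewrite notin_setE/= in_itv/= andbT => ax.
rewrite (_ : xsection S x = set0) ?measure0 ?mul0e//.
by rewrite -subset0 => y; rewrite /xsection/= inE => -[].
Qed.

Theorem mainTheorem1 (R : realType) (d : measure_display)
    (T : measurableType d) (P : probability T R) (X Y : {RV P >-> R})
    (N k : nat) (hk : (1 <= k <= N)%N)
    (g1 g2 rho1 rho2 zeta : R)
    (hg1 : 0 < g1) (hg2 : 0 < g2)
    (hrho1 : 0 <= rho1 <= 1) (hrho2 : 0 <= rho2 <= 1)
    (hX0 : {ae P, forall w, 0 <= X w}) (hY0 : {ae P, forall w, 0 <= Y w})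
    (hXY : independent_RV X Y)
    (hX : has_density X (hop1_pdf N k g1 g2 rho1))
    (hY : forall x : R, 0 <= x -> cdf Y x = (hop2_cdf N k g1 g2 rho2 x)%:E)
    (hzeta : 1 <= zeta) (gth : R) (hgth : 0 < gth) :
  let EX := fine 'E_P[X] in
  let c := EX + zeta in
  P [set w | X w * Y w / (zeta * Y w + EX + zeta) < gth] =
  (1 - 2 * k%:R ^+ 2 / g1 * 'C(N, k)%:R ^+ 2 *
     \sum_(0 <= m < k) \sum_(0 <= n < k) \sum_(1 <= i < 3) \sum_(1 <= j < 3)
       coefS N k g1 g2 m * coefP N k g1 g2 n
       * coefT N k g1 g2 m i * coefQ N k g1 g2 rho1 n j
       * Num.sqrt (coefU N k g1 g2 rho2 m i * c * gth
                     / coefR N k g1 g2 rho1 n j)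
       * expR (- (coefR N k g1 g2 rho1 n j * zeta * gth / g1))
       * besselK 1 (2 / g1 * Num.sqrt (coefU N k g1 g2 rho2 m i
                                         * coefR N k g1 g2 rho1 n j
                                         * c * gth)))%:E.
Proof.
move=> EX c.
have zeta0 : 0 < zeta by exact: lt_le_trans hzeta.
have EX0 : 0 <= EX.
  rewrite /EX fine_ge0// expectation_def.
  (* [X] is nonnegative only almost everywhere, whence its replacement by [max 0 X]. *)
  rewrite (@ae_eq_integral _ _ _ P setT (fun w => (Num.max 0 (X w))%:E))//.
  - by apply: integral_ge0 => w _; rewrite lee_fin le_max lexx.
  - exact/measurable_EFinP.
  - by apply/measurable_EFinP; exact: measurable_maxr.
  - by apply: filterS hX0 => w Xw _; rewrite max_r.
have c0 : 0 < c by rewrite ltr_wpDl.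
pose a := zeta * gth; pose kappa := c * gth.
have a0 : 0 < a by rewrite mulr_gt0.
have kappa0 : 0 < kappa by rewrite mulr_gt0.
pose z w := zeta * Y w + EX + zeta.
have mXw : measurable_fun setT X by exact: measurable_funPT.
have mYw : measurable_fun setT Y by exact: measurable_funPT.
have mz : measurable_fun setT z.
  apply: measurable_funD => //; apply: measurable_funD => //.
  exact: measurable_funM.
pose A := [set w | X w * Y w / z w < gth].
pose B := [set w | a < X w /\ kappa <= Y w * (X w - a)].
rewrite -[X in P X]/A.
(* On a null set [z] may be negative or zero. Multiplying by its square avoids its sign. Where
   [z w = 0], the quotient is [0] by convention, so [w] lies in [A] because [0 < gth]. *)
have ltz2 w : z w != 0 ->
    (X w * Y w / z w < gth) = (X w * Y w * z w < gth * z w ^+ 2).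
  move=> z0; have z2 : 0 < z w ^+ 2 by rewrite exprn_even_gt0.
  rewrite -(ltr_pM2r z2); congr (_ < _); by field.
have mA : measurable A.
  have -> : A = (fun w => (z w == 0) || (X w * Y w * z w < gth * z w ^+ 2))
      @^-1` [set true].
    apply/seteqP; split=> w; rewrite /A/=; have [->|z0] := eqVneq (z w) 0 => //=.
    - by rewrite ltz2.
    - by rewrite invr0 mulr0.
    - by rewrite ltz2.
  rewrite -[X in measurable X]setTI; apply: measurable_or => //.
    exact: measurable_fun_eqr.
  apply: measurable_fun_ltr; first by do 2 apply: measurable_funM => //.
  by apply: measurable_funM => //; exact: measurable_funX.
have mB : measurable B.
  have -> : B = (fun w => (a < X w) && (kappa <= Y w * (X w - a)))
      @^-1` [set true].
    by apply/seteqP; split=> w /= => [[-> ->]|/andP[]].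
  rewrite -[X in measurable X]setTI.
  apply: measurable_and => //; first exact: measurable_fun_ltr.
  apply: measurable_fun_ler => //; apply: measurable_funM => //.
  exact: measurable_funB.
have AB : {ae P, forall w, A w <-> (~` B) w}.
  apply: filterS hY0 => w Yw; rewrite /A /B/=.
  have zw0 : 0 < z w by rewrite /z -addrA ltr_wpDl// mulr_ge0// ltW.
  have zE : Y w * (X w - a) - kappa = X w * Y w - gth * z w.
    by rewrite /a /kappa /c /z; ring.
  rewrite ltr_pdivrMr//; split=> [lt [_ ge]|nB].
    by move: lt; rewrite -subr_lt0 -zE subr_lt0 ltNge ge.
  rewrite ltNge; apply/negP => ge; apply: nB.
  have ge' : kappa <= Y w * (X w - a) by rewrite -subr_ge0 zE subr_ge0.
  (* The bound [a < X w] is automatic: [Y w * (X w - a)] is at least [kappa > 0] and [Y w] is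
     nonnegative. *)
  split=> //; rewrite -subr_gt0; have := lt_le_trans kappa0 ge'.
  rewrite pmulr_rgt0// lt_neqAle Yw andbT; apply/eqP => Y0.
  by move: ge'; rewrite -Y0 mul0r leNgt kappa0.
transitivity (P (~` B)); first exact: ae_iff_measure (measurableC mB) AB.
rewrite probability_setC// EFinB.
congr (_ - _)%E.
pose ccdf y := 1 - hop2_cdf N k g1 g2 rho2 y.
have Yccdf y : 0 < y -> distribution P Y `[y, +oo[ = (ccdf y)%:E.
  move=> y0; rewrite distribution_itvcy EFinB; congr (_ - _)%E.
  apply: distribution_itvNyo; last exact: continuous_hop2_cdf.
  (* The CDF formula is given only for [0 <= x]; as [0 < y], it holds throughout a neighbourhood of
     [y]. *)
  by apply: filterS (lt_nbhsr y0) => x x0; rewrite hY// ltW.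
rewrite (distribution_snr_region a hXY kappa0 hX Yccdf).
have Rp n j := coefR_gt0 N k hg1 hg2 hrho1 n j.
have Up m i := coefU_gt0 N k hg1 hg2 hrho2 m i.
pose s m n i j := coefS N k g1 g2 m * coefP N k g1 g2 n *
  coefT N k g1 g2 m i * coefQ N k g1 g2 rho1 n j.
pose U := coefU N k g1 g2 rho2; pose Rc := coefR N k g1 g2 rho1.
pose e m n i j x :=
  expR (- (U m i * (kappa / (x - a)) / g1)) * expR (- (Rc n j * x / g1)).
have fE x : a < x -> ccdf (kappa / (x - a)) * hop1_pdf N k g1 g2 rho1 x =
    k%:R ^+ 2 / g1 * 'C(N, k)%:R ^+ 2 *
    \sum_(0 <= m < k) \sum_(0 <= n < k) \sum_(1 <= i < 3) \sum_(1 <= j < 3)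
      s m n i j * e m n i j x.
  move=> ax; rewrite /ccdf /hop2_cdf opprB addrC subrK.
  (* Since [0 < a < x], the density is given by its nonzero branch; the product of the two double
     sums then expands into the fourfold sum. *)
  rewrite /hop1_pdf (ltW (lt_trans a0 ax)) mulrACA big_distrlr/=.
  congr (_ * _); first by ring.
  apply: eq_bigr => m _; apply: eq_bigr => n _; rewrite big_distrlr/=.
  apply: eq_bigr => i _; apply: eq_bigr => j _.
  by rewrite /s /e mulrACA; congr (_ * _); ring.
pose v m n i j := Num.sqrt (U m i * kappa / Rc n j) * expR (- (Rc n j * a / g1))
  * besselK 1 (2 / g1 * Num.sqrt (U m i * Rc n j * kappa)).
have [_ I] : has_integral lebesgue_measure `]a, +oo[
  (fun x => k%:R ^+ 2 / g1 * 'C(N, k)%:R ^+ 2 *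
    \sum_(0 <= m < k) \sum_(0 <= n < k) \sum_(1 <= i < 3) \sum_(1 <= j < 3)
      s m n i j * e m n i j x)
  (k%:R ^+ 2 / g1 * 'C(N, k)%:R ^+ 2 *
    \sum_(0 <= m < k) \sum_(0 <= n < k) \sum_(1 <= i < 3) \sum_(1 <= j < 3)
      s m n i j * (v m n i j * 2)).
  apply: has_integralZ => //; apply: has_integral_sum => // m.
  apply: has_integral_sum => // n; apply: has_integral_sum => // i.
  apply: has_integral_sum => // j; apply: has_integralZ => //.
  exact: has_integral_expR_expRV.
under eq_integral => x do rewrite inE/= in_itv/= andbT => /fE ->.
rewrite I; congr EFin.
(* The prefactor 2 is the one each Bessel integral carries; it is distributed back over the
   terms. *)
have -> : 2 * k%:R ^+ 2 / g1 * 'C(N, k)%:R ^+ 2 =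
    k%:R ^+ 2 / g1 * 'C(N, k)%:R ^+ 2 * 2 by ring.
rewrite -[RHS]mulrA; congr (_ * _); rewrite mulr_sumr.
apply: eq_bigr => m _; rewrite mulr_sumr; apply: eq_bigr => n _.
rewrite mulr_sumr; apply: eq_bigr => i _; rewrite mulr_sumr.
apply: eq_bigr => j _; rewrite [RHS]mulrC mulrA; congr (_ * 2).
rewrite /v 2!mulrA -/(s m n i j); congr (_ * Num.sqrt _ * expR _ * besselK 1 _).
- by rewrite /kappa mulrA.
- by rewrite /a mulrA.
- by rewrite /kappa mulrA.
Qed.
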